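(* Each of the following quaternary sums is universal over $\mathbb{Z}$: $2p_5+2p_5+p_8+p_8$, $p_8+p_8+p_8+p_8$, $3p_4+3p_4+p_8+p_8$, $6p_3+3p_4+2p_5+p_8$, $3p_3+p_5+2p_5+2p_5$, $3p_3+p_5+p_8+p_8$, $3p_4+p_5+p_5+p_8$, $6p_3+p_5+p_5+2p_5$, $p_5+p_5+p_5+4p_5$, $p_5+p_5+p_5+2p_8$, $p_3+p_3+2p_4+3p_5$, $p_3+p_3+4p_3+3p_5$, $p_4+2p_5+3p_5+4p_5$, $p_4+2p_5+3p_5+2p_8$, $2p_5+2p_5+2p_5+p_8$, $2p_5+p_8+p_8+p_8$.
   Context: For an integer $m\ge 3$ and $x\in\mathbb{Z}$, the generalized $m$-gonal number is $p_m(x)=\frac{(m-2)x^2-(m-4)x}{2}$; thus $p_3(x)=x(x+1)/2$, $p_4(x)=x^2$, $p_5(x)=x(3x-1)/2$, $p_8(x)=x(3x-2)$. For positive integers $a,b,c,d$ and $r,s,t,u\ge 3$, the notation $ap_r+bp_s+cp_t+dp_u$ denotes the function $(h,l,m,n)\mapsto ap_r(h)+bp_s(l)+cp_t(m)+dp_u(n)$ on $\mathbb{Z}^4$ (four independent integer variables). Such a sum is called universal over $\mathbb{Z}$ if its set of values $\{ap_r(h)+bp_s(l)+cp_t(m)+dp_u(n): h,l,m,n\in\mathbb{Z}\}$ equals $\mathbb{N}_0=\{0,1,2,\dots\}$. *)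

(* Defs.v *)
From Stdlib Require Import ZArith List.
Import ListNotations.
Open Scope Z_scope.

(* generalized m-gonal number p_m(x) = ((m-2)x^2 - (m-4)x)/2 ; the numerator is always even *)
Definition polyg (m x : Z) : Z := ((m - 2) * x * x - (m - 4) * x) / 2.

Definition quat_sum (a r b s c t d u : Z) (h l m n : Z) : Z :=
  a * polyg r h + b * polyg s l + c * polyg t m + d * polyg u n.

Definition universal_Z (a r b s c t d u : Z) : Prop :=
  forall N : Z, (0 <= N <-> exists h l m n : Z, quat_sum a r b s c t d u h l m n = N).

(* the sixteen sums, as tuples ((a,r),(b,s),(c,t),(d,u)) *)
Definition sums_3p3 : list (Z * Z * Z * Z * Z * Z * Z * Z) :=
  [ (2,5, 2,5, 1,8, 1,8);
    (1,8, 1,8, 1,8, 1,8);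
    (3,4, 3,4, 1,8, 1,8);
    (6,3, 3,4, 2,5, 1,8);
    (3,3, 1,5, 2,5, 2,5);
    (3,3, 1,5, 1,8, 1,8);
    (3,4, 1,5, 1,5, 1,8);
    (6,3, 1,5, 1,5, 2,5);
    (1,5, 1,5, 1,5, 4,5);
    (1,5, 1,5, 1,5, 2,8);
    (1,3, 1,3, 2,4, 3,5);
    (1,3, 1,3, 4,3, 3,5);
    (1,4, 2,5, 3,5, 4,5);
    (1,4, 2,5, 3,5, 2,8);
    (2,5, 2,5, 2,5, 1,8);
    (2,5, 1,8, 1,8, 1,8) ].

(* Main.v *)
(* Completing squares turns each sum into a representation of some [k N + l] by four squares (after
   combinations [2 u^2 + 2 v^2 = (u + v)^2 + (u - v)^2]) with prescribed residues modulo 2 and 3.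
   Lagrange's theorem provides four squares, and residues of [k N + l] modulo 8 and 3 settle all
   conditions except one: when three of the terms are divisible by 3 they may have to be prime
   to 3. This is arranged by reflections: a nonzero [9 (a^2 + b^2 + c^2)] is always a sum of
   three squares prime to 3. *)
Require Import Defs.
From Stdlib Require Import ZArith List.
From Stdlib Require Import Znumtheory Lia.
Import ListNotations.

(** A square is 0 or 1 modulo 3, so [n] modulo 3 fixes the number of terms prime to 3 only up to
    multiples of 3. For [n] = 2 that number is 2; for [n] = 1 it is 1 or 4, and the reflections turn
    the first case into the second. They fail only if the other three terms vanish, that is, if [n]
    is a square written trivially; hence Lagrange's theorem is sharpened to [four_squares_proper].
    As the variables run over all integers, the sign of a square root is free: a root [y] serves
    [p_3] if it is odd, [p_5] if it is prime to 6 and [p_8] if it is prime to 3. *)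

Ltac Zify.zify_post_hook ::= Z.to_euclidean_division_equations.

(** * Lagrange's four-square theorem *)

(** Pigeonhole for odd [p]: for [0 <= x, y <= (p - 1) / 2] the residues of [x^2] are distinct, and
    so are those of [-1 - y^2]. These are [p + 1] residues in all, so the two families meet; the
    bound on [x] and [y] gives [m < p]. *)
Lemma prime_divides_sum_two_squares_succ (p : Z) :
  prime p -> exists x y m : Z, x * x + y * y + 1 = m * p /\ 0 < m < p.
Proof.
  intros Hp. pose proof (prime_ge_2 p Hp) as Hp2.
  destruct (Z.eq_dec p 2) as [->|Hne2]. { exists 1, 0, 1. lia. }
  assert (Hodd : p mod 2 = 1).
  { assert (H : ~ (2 | p)).
    { intros H. destruct (prime_divisors p Hp 2 H) as [E|[E|[E|E]]]; lia. }
    rewrite <- Z.mod_divide in H by lia. lia. }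
  set (h := Z.to_nat ((p + 1) / 2)).
  assert (Hh : 2 * Z.of_nat h = p + 1) by (unfold h; lia).
  set (f := fun x : nat => (Z.of_nat x * Z.of_nat x) mod p).
  set (g := fun x : nat => (- 1 - Z.of_nat x * Z.of_nat x) mod p).
  assert (Hinj : forall x y : nat, (x < h)%nat -> (y < h)%nat ->
    (p | Z.of_nat x * Z.of_nat x - Z.of_nat y * Z.of_nat y) -> x = y).
  { intros x y Hx Hy H.
    replace (Z.of_nat x * Z.of_nat x - Z.of_nat y * Z.of_nat y)
      with ((Z.of_nat x - Z.of_nat y) * (Z.of_nat x + Z.of_nat y)) in H by ring.
    (* Both [x - y] and [x + y] are smaller than [p] in absolute value. *)
    destruct (prime_mult p Hp _ _ H) as [[k Hk]|[k Hk]];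
      (assert (k = 0) by (clear - Hk Hx Hy Hh; nia)); subst k; lia. }
  assert (Hmod : forall u v : Z, u mod p = v mod p -> (p | u - v)).
  { intros u v H. apply Z.mod_divide; [lia|].
    rewrite Zminus_mod, H, Z.sub_diag. apply Z.mod_0_l; lia. }
  assert (Hnd : forall F : nat -> Z,
    (forall x y, In x (seq 0 h) -> In y (seq 0 h) -> F x = F y -> x = y) ->
    NoDup (map F (seq 0 h))).
  { intros F HF. apply NoDup_map_NoDup_ForallPairs; [|apply seq_NoDup].
    intros x y Hx Hy. now apply HF. }
  assert (Hf : NoDup (map f (seq 0 h))).
  { apply Hnd. intros x y Hx Hy E. apply in_seq in Hx, Hy.
    apply Hinj; [lia|lia|]. apply Hmod. exact E. }
  assert (Hg : NoDup (map g (seq 0 h))).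
  { apply Hnd. intros x y Hx Hy E. apply in_seq in Hx, Hy.
    symmetry. apply Hinj; [lia|lia|]. apply Hmod in E.
    now replace (Z.of_nat y * Z.of_nat y - Z.of_nat x * Z.of_nat x)
      with (- 1 - Z.of_nat x * Z.of_nat x - (- 1 - Z.of_nat y * Z.of_nat y)) by ring. }
  assert (Hcommon : exists z, In z (map f (seq 0 h)) /\ In z (map g (seq 0 h))).
  { destruct (List.Exists_dec (fun z => In z (map g (seq 0 h))) (map f (seq 0 h))) as [E|E].
    - intros z. apply in_dec, Z.eq_dec.
    - apply Exists_exists in E. exact E.
    - exfalso.
      assert (Hall : NoDup (map f (seq 0 h) ++ map g (seq 0 h))).
      { apply NoDup_app; [exact Hf|exact Hg|].
        intros z Hz1 Hz2. apply E, Exists_exists. now exists z. }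
      assert (Hincl : incl (map f (seq 0 h) ++ map g (seq 0 h))
                           (map Z.of_nat (seq 0 (Z.to_nat p)))).
      { intros z Hz. assert (0 <= z < p).
        { apply in_app_or in Hz. destruct Hz as [Hz|Hz]; apply in_map_iff in Hz;
            destruct Hz as [x [<- _]]; apply Z.mod_pos_bound; lia. }
        apply in_map_iff. exists (Z.to_nat z). split; [lia|]. apply in_seq. lia. }
      pose proof (NoDup_incl_length Hall Hincl) as L.
      rewrite length_app, !length_map, !length_seq in L. lia. }
  destruct Hcommon as [z [Hz1 Hz2]].
  apply in_map_iff in Hz1, Hz2.
  destruct Hz1 as [x [Hx1 Hx2]], Hz2 as [y [Hy1 Hy2]].
  apply in_seq in Hx2, Hy2.
  assert (E : f x = g y) by congruence.
  apply Hmod in E. destruct E as [m Hm].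
  exists (Z.of_nat x), (Z.of_nat y), m. split; [lia|]. nia.
Qed.

Lemma centered_residue (m a : Z) :
  0 < m -> exists k r : Z, a = r + m * k /\ - m <= 2 * r <= m.
Proof.
  intros Hm. exists ((2 * a + m) / (2 * m)), (a - m * ((2 * a + m) / (2 * m))).
  pose proof (Z.div_mod (2 * a + m) (2 * m)).
  pose proof (Z.mod_pos_bound (2 * a + m) (2 * m)). lia.
Qed.

(** Descent on the multiplier [m] of [p]: the centered residues of the four terms have square sum
    [m * R] with [R <= m], and Euler's identity applied to [m * p] and [m * R] yields [R * p]. The
    extreme cases [R = 0] and [R = m] would make [m] divide [p]. *)
Lemma prime_four_squares (p : Z) :
  prime p -> exists a b c d : Z, a * a + b * b + c * c + d * d = p.
Proof.
  intros Hp. pose proof (prime_ge_2 p Hp) as Hp2.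
  destruct (prime_divides_sum_two_squares_succ p Hp) as [x [y [m0 [E0 Hm0]]]].
  assert (Hdesc : forall m : Z, 0 <= m -> 0 < m < p ->
    (exists a b c d : Z, a * a + b * b + c * c + d * d = m * p) ->
    exists a b c d : Z, a * a + b * b + c * c + d * d = p).
  { intros m Hm. pattern m. apply Zlt_0_ind; [|exact Hm]. clear m Hm.
    intros m IH _ Hm [a [b [c [d E]]]].
    destruct (Z.eq_dec m 1) as [->|Hm1].
    { exists a, b, c, d. lia. }
    destruct (centered_residue m a) as [k1 [r1 [-> H1]]]; [lia|].
    destruct (centered_residue m b) as [k2 [r2 [-> H2]]]; [lia|].
    destruct (centered_residue m c) as [k3 [r3 [-> H3]]]; [lia|].
    destruct (centered_residue m d) as [k4 [r4 [-> H4]]]; [lia|].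
    assert (Hndiv : forall k, p <> m * k).
    { intros k Hk.
      destruct (prime_divisors p Hp m) as [?|[?|[?|?]]]; try lia.
      exists k. lia. }
    set (S := r1 * k1 + r2 * k2 + r3 * k3 + r4 * k4).
    (* This is the sum of the squared residues divided by [m], read off from expanding the squares
       of [r + m * k] in [E]. *)
    set (R := p - 2 * S - m * (k1 * k1 + k2 * k2 + k3 * k3 + k4 * k4)).
    assert (ER : r1 * r1 + r2 * r2 + r3 * r3 + r4 * r4 = m * R)
      by (unfold R, S; nia).
    assert (Q1 : 4 * (r1 * r1) <= m * m) by nia.
    assert (Q2 : 4 * (r2 * r2) <= m * m) by nia.
    assert (Q3 : 4 * (r3 * r3) <= m * m) by nia.
    assert (Q4 : 4 * (r4 * r4) <= m * m) by nia.
    assert (HR0 : 0 <= R) by nia.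
    assert (HRm : R <= m) by nia.
    destruct (Z.eq_dec R 0) as [R0|R0].
    { exfalso. rewrite R0 in ER.
      assert (r1 = 0) by nia. assert (r2 = 0) by nia.
      assert (r3 = 0) by nia. assert (r4 = 0) by nia. subst r1 r2 r3 r4.
      apply (Hndiv (k1 * k1 + k2 * k2 + k3 * k3 + k4 * k4)). unfold R, S in R0. lia. }
    destruct (Z.eq_dec R m) as [Rm|Rm].
    { exfalso. rewrite Rm in ER.
      (* [R = m] forces every residue to be [m / 2] or [- m / 2], so [2 * S] is divisible by [m]. *)
      assert (G : forall r k, 4 * (r * r) = m * m -> exists e, 2 * (r * k) = m * e).
      { intros r k H. assert (H' : (2 * r - m) * (2 * r + m) = 0) by lia.
        apply Z.mul_eq_0 in H'. destruct H' as [H'|H'].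
        - exists k. replace m with (2 * r) by lia. ring.
        - exists (- k). replace m with (- (2 * r)) by lia. ring. }
      destruct (G r1 k1) as [e1 G1]; [lia|]. destruct (G r2 k2) as [e2 G2]; [lia|].
      destruct (G r3 k3) as [e3 G3]; [lia|]. destruct (G r4 k4) as [e4 G4]; [lia|].
      apply (Hndiv (1 + e1 + e2 + e3 + e4 + (k1 * k1 + k2 * k2 + k3 * k3 + k4 * k4))).
      unfold R, S in Rm. lia. }
    apply (IH R); [lia|lia|].
    (* The components of Euler's product of the terms [r + m * k] with the residues [r], divided by
       [m]: the first is [m * R + m * S], and in the others the products of two residues cancel. *)
    exists (R + S), (k1 * r2 - k2 * r1 + k3 * r4 - k4 * r3),
      (k1 * r3 - k3 * r1 + k4 * r2 - k2 * r4), (k1 * r4 - k4 * r1 + k2 * r3 - k3 * r2).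
    (* Euler's identity, divided by [m ^ 2]. *)
    apply (Z.mul_reg_l _ _ (m * m)); [nia|].
    replace (m * m * (R * p)) with ((m * p) * (m * R)) by ring.
    replace (m * m * _) with
      ((m * R + m * S) * (m * R + m * S)
       + m * m * ((k1 * r2 - k2 * r1 + k3 * r4 - k4 * r3) * (k1 * r2 - k2 * r1 + k3 * r4 - k4 * r3)
       + (k1 * r3 - k3 * r1 + k4 * r2 - k2 * r4) * (k1 * r3 - k3 * r1 + k4 * r2 - k2 * r4)
       + (k1 * r4 - k4 * r1 + k2 * r3 - k3 * r2) * (k1 * r4 - k4 * r1 + k2 * r3 - k3 * r2))) by ring.
    rewrite <- E, <- ER. unfold S. ring. }
  apply (Hdesc m0); [lia|lia|].
  exists x, y, 1, 0. lia.
Qed.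

Theorem lagrange_four_squares (n : Z) :
  0 <= n -> exists a b c d : Z, a * a + b * b + c * c + d * d = n.
Proof.
  intros Hn. pattern n. apply Zlt_0_ind; [|exact Hn]. clear n Hn.
  intros n IH Hn.
  destruct (Z.eq_dec n 0) as [->|H0]. { now exists 0, 0, 0, 0. }
  destruct (Z.eq_dec n 1) as [->|H1]. { now exists 1, 0, 0, 0. }
  destruct (prime_dec n) as [P|P]. { now apply prime_four_squares. }
  apply not_prime_divide in P; [|lia].
  destruct P as [u [Hu [v Hv]]].
  destruct (IH u) as [a [b [c [d E]]]]; [lia|].
  destruct (IH v) as [a' [b' [c' [d' E']]]]; [nia|].
  exists (a * a' + b * b' + c * c' + d * d'), (a * b' - b * a' + c * d' - d * c'),
    (a * c' - c * a' + d * b' - b * d'), (a * d' - d * a' + b * c' - c * b').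
  rewrite Hv, <- E, <- E'. ring.
Qed.

(* An even square [4y^2] is [y^2+y^2+y^2+y^2]; for odd [x = a^2+b^2+c^2+d^2], use
   [x^2 = (a^2-b^2-c^2-d^2)^2 + (2ab)^2 + (2ac)^2 + (2ad)^2], whose first term is odd. *)
Lemma four_squares_proper (n : Z) :
  1 < n -> exists a b c d : Z, a * a + b * b + c * c + d * d = n
    /\ a * a < n /\ b * b < n /\ c * c < n /\ d * d < n.
Proof.
  intros Hn1. assert (Hn : 0 <= n) by lia. revert Hn1. pattern n.
  apply Zlt_0_ind; [|exact Hn]. clear n Hn.
  intros n IH _ Hn.
  assert (Hsq : forall x, x * x = n -> exists a b c d : Z,
    a * a + b * b + c * c + d * d = n
    /\ a * a < n /\ b * b < n /\ c * c < n /\ d * d < n).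
  { intros x0 Hx0. set (x := Z.abs x0).
    assert (Hx : x * x = n) by (unfold x; lia).
    assert (Hx1 : 0 <= x) by (unfold x; lia). clearbody x. clear x0 Hx0.
    assert (Hx2 : 1 < x) by nia.
    destruct (Z.eq_dec (x mod 2) 0) as [Ev|Od].
    { exists (x / 2), (x / 2), (x / 2), (x / 2).
      assert (Ex : x = 2 * (x / 2)) by lia.
      set (y := x / 2) in *. clearbody y. subst x. nia. }
    assert (K : forall a b c d, a * a + b * b + c * c + d * d = x -> a <> 0 -> a * a < x ->
      exists a b c d : Z, a * a + b * b + c * c + d * d = n
      /\ a * a < n /\ b * b < n /\ c * c < n /\ d * d < n).
    { intros a b c d E Ha Hax.
      set (e := a * a - b * b - c * c - d * d).
      assert (He : e * e + (2 * a * b) * (2 * a * b) + (2 * a * c) * (2 * a * c)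
                   + (2 * a * d) * (2 * a * d) = n)
        by (unfold e; rewrite <- Hx, <- E; ring).
      (* Here [e = 2 a^2 - x] with [x] odd. *)
      assert (He0 : e <> 0).
      { replace e with (2 * (a * a) - x) by (unfold e; lia). lia. }
      assert (Hpos : 0 < (2 * a * b) * (2 * a * b) + (2 * a * c) * (2 * a * c)
                   + (2 * a * d) * (2 * a * d)).
      { replace (_ + _) with (4 * ((a * a) * (x - a * a))) by (rewrite <- E; ring). nia. }
      exists e, (2 * a * b), (2 * a * c), (2 * a * d).
      assert (0 < e * e) by nia.
      pose proof (Z.square_nonneg (2 * a * b)). pose proof (Z.square_nonneg (2 * a * c)).
      pose proof (Z.square_nonneg (2 * a * d)). lia. }
    destruct (IH x) as [a [b [c [d [E [Ha [Hb [Hc Hd]]]]]]]]; [nia|lia|].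
    destruct (Z.eq_dec a 0) as [->|Ha0]; [|now apply (K a b c d)].
    destruct (Z.eq_dec b 0) as [->|Hb0]; [|apply (K b 0 c d); lia].
    destruct (Z.eq_dec c 0) as [->|Hc0]; [|apply (K c 0 0 d); lia].
    apply (K d 0 0 0); lia. }
  destruct (lagrange_four_squares n) as [a [b [c [d E]]]]; [lia|].
  destruct (Z.eq_dec (a * a) n); [now apply (Hsq a)|].
  destruct (Z.eq_dec (b * b) n); [now apply (Hsq b)|].
  destruct (Z.eq_dec (c * c) n); [now apply (Hsq c)|].
  destruct (Z.eq_dec (d * d) n); [now apply (Hsq d)|].
  exists a, b, c, d.
  pose proof (Z.square_nonneg a). pose proof (Z.square_nonneg b).
  pose proof (Z.square_nonneg c). pose proof (Z.square_nonneg d). lia.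
Qed.

(** * Squares modulo 3 and 8, and sorting of the four terms *)

Lemma square_by_residue_mod_3 (x : Z) :
  x mod 3 = 0 /\ (exists q, x * x = 9 * q) \/ x mod 3 <> 0 /\ (exists q, x * x = 3 * q + 1).
Proof.
  assert (C : x = 3 * (x / 3) \/ x = 3 * (x / 3) + 1 \/ x = 3 * (x / 3) + 2) by lia.
  set (q := x / 3) in C. clearbody q. destruct C as [C|[C|C]].
  - left. split; [lia|]. exists (q * q). subst x. ring.
  - right. split; [lia|]. exists (3 * q * q + 2 * q). subst x. ring.
  - right. split; [lia|]. exists (3 * q * q + 4 * q + 1). subst x. ring.
Qed.

Lemma square_by_parity (x : Z) :
  x mod 2 = 0 /\ (exists q, x * x = 4 * q) \/ x mod 2 = 1 /\ (exists q, x * x = 8 * q + 1).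
Proof.
  assert (C : x = 2 * (x / 2) \/ x = 4 * (x / 4) + 1 \/ x = 4 * (x / 4) + 3) by lia.
  set (p := x / 2) in C. set (q := x / 4) in C. clearbody p q. destruct C as [C|[C|C]].
  - left. split; [lia|]. exists (p * p). subst x. ring.
  - right. split; [lia|]. exists (2 * q * q + q). subst x. ring.
  - right. split; [lia|]. exists (2 * q * q + 3 * q + 1). subst x. ring.
Qed.

(** [P] is the property to sort by. [Q] is shared by all four terms and survives the permutation, so
    that terms prime to 3 can be sorted by parity. *)
Lemma sort_four_squares (P Q : Z -> Prop) (n : Z) :
  (forall x, P x \/ ~ P x) ->
  (exists a b c d : Z, a * a + b * b + c * c + d * d = n /\ Q a /\ Q b /\ Q c /\ Q d) ->
  exists a b c d : Z, a * a + b * b + c * c + d * d = n /\ (Q a /\ Q b /\ Q c /\ Q d)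
    /\ (P a /\ P b /\ P c /\ P d \/ P a /\ P b /\ P c /\ ~ P d \/
        P a /\ P b /\ ~ P c /\ ~ P d \/ P a /\ ~ P b /\ ~ P c /\ ~ P d \/
        ~ P a /\ ~ P b /\ ~ P c /\ ~ P d).
Proof.
  intros Pdec [a [b [c [d [E [A [B [C D]]]]]]]].
  destruct (Pdec a), (Pdec b), (Pdec c), (Pdec d);
  [ exists a, b, c, d | exists a, b, c, d | exists a, b, d, c | exists a, b, c, d
  | exists a, c, d, b | exists a, c, b, d | exists a, d, b, c | exists a, b, c, d
  | exists b, c, d, a | exists b, c, a, d | exists b, d, a, c | exists b, a, c, d
  | exists c, d, a, b | exists c, a, b, d | exists d, a, b, c | exists a, b, c, d ];
  (split; [lia|tauto]).
Qed.

(** The number of odd terms is congruent to [n] modulo 4. Residue 0 has no clause because it allows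
    both 0 and 4 odd terms. *)
Lemma sort_by_parity (Q : Z -> Prop) (n : Z) :
  (exists a b c d : Z, a * a + b * b + c * c + d * d = n /\ Q a /\ Q b /\ Q c /\ Q d) ->
  exists a b c d : Z, a * a + b * b + c * c + d * d = n /\ (Q a /\ Q b /\ Q c /\ Q d)
    /\ (n mod 4 = 1 -> a mod 2 = 1 /\ b mod 2 = 0 /\ c mod 2 = 0 /\ d mod 2 = 0)
    /\ (n mod 4 = 2 -> a mod 2 = 1 /\ b mod 2 = 1 /\ c mod 2 = 0 /\ d mod 2 = 0)
    /\ (n mod 4 = 3 -> a mod 2 = 1 /\ b mod 2 = 1 /\ c mod 2 = 1 /\ d mod 2 = 0).
Proof.
  intros H. apply (sort_four_squares (fun x => x mod 2 = 1)) in H; [|lia].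
  destruct H as [a [b [c [d [E [H S]]]]]].
  exists a, b, c, d. split; [exact E|]. split; [exact H|]. clear H.
  assert (Hn : n = 4 * (n / 4) + n mod 4) by lia.
  generalize dependent (n / 4). intros k.
  generalize dependent (n mod 4). intros r Hr.
  destruct (square_by_parity a) as [[a2 [qa Ea]]|[a2 [qa Ea]]],
    (square_by_parity b) as [[b2 [qb Eb]]|[b2 [qb Eb]]],
    (square_by_parity c) as [[c2 [qc Ec]]|[c2 [qc Ec]]],
    (square_by_parity d) as [[d2 [qd Ed]]|[d2 [qd Ed]]];
    rewrite a2, b2, c2, d2 in *; clear a2 b2 c2 d2; lia.
Qed.

Lemma sort_mod_3 (Q : Z -> Prop) (n : Z) :
  n mod 3 = 2 ->
  (exists a b c d : Z, a * a + b * b + c * c + d * d = n /\ Q a /\ Q b /\ Q c /\ Q d) ->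
  exists a b c d : Z, a * a + b * b + c * c + d * d = n /\ (Q a /\ Q b /\ Q c /\ Q d)
    /\ a mod 3 <> 0 /\ b mod 3 <> 0 /\ c mod 3 = 0 /\ d mod 3 = 0.
Proof.
  intros Hn H. apply (sort_four_squares (fun x => x mod 3 <> 0)) in H; [|lia].
  destruct H as [a [b [c [d [E [H S]]]]]].
  exists a, b, c, d. split; [exact E|]. split; [exact H|]. clear H.
  assert (Hk : n = 3 * (n / 3) + 2) by lia. clear Hn.
  generalize dependent (n / 3). intros k Hk.
  destruct (square_by_residue_mod_3 a) as [[a2 [qa Ea]]|[a2 [qa Ea]]],
    (square_by_residue_mod_3 b) as [[b2 [qb Eb]]|[b2 [qb Eb]]],
    (square_by_residue_mod_3 c) as [[c2 [qc Ec]]|[c2 [qc Ec]]],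
    (square_by_residue_mod_3 d) as [[d2 [qd Ed]]|[d2 [qd Ed]]];
    first [exfalso; clear - E Ea Eb Ec Ed Hk; lia | tauto].
Qed.

(** * Making terms prime to 3 by reflections *)

(* Three times the reflection in the plane orthogonal to [(1,1,1)] sends [v] to
   [3v - 2s(1,1,1)], where [s] is the sum of the coordinates of [v]. After sign changes
   [s] is prime to 3 unless [v] is divisible by 3. *)
Lemma nine_times_three_squares_primitive (a b c : Z) :
  a mod 3 <> 0 \/ b mod 3 <> 0 \/ c mod 3 <> 0 ->
  exists x y z : Z, x * x + y * y + z * z = 9 * (a * a + b * b + c * c)
    /\ x mod 3 <> 0 /\ y mod 3 <> 0 /\ z mod 3 <> 0.
Proof.
  intros H.
  assert (K : forall a b c, (a + b + c) mod 3 <> 0 ->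
    exists x y z : Z, x * x + y * y + z * z = 9 * (a * a + b * b + c * c)
    /\ x mod 3 <> 0 /\ y mod 3 <> 0 /\ z mod 3 <> 0).
  { clear. intros a b c H.
    exists (3 * a - 2 * (a + b + c)), (3 * b - 2 * (a + b + c)), (3 * c - 2 * (a + b + c)).
    split; [ring|lia]. }
  (* The first sum differs from each other one by twice a coordinate, so all four vanish modulo 3
     only if [a], [b] and [c] do. *)
  assert (C : (a + b + c) mod 3 <> 0 \/ (- a + b + c) mod 3 <> 0
    \/ (a + - b + c) mod 3 <> 0 \/ (a + b + - c) mod 3 <> 0) by lia.
  destruct C as [C|[C|[C|C]]]; apply K in C; rewrite ?Z.mul_opp_opp in C; exact C.
Qed.

(** If 3 divides all coordinates, induction on the sum of squares rewrites [a^2 + b^2 + c^2], which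
    is 9 times a smaller sum, with terms prime to 3; the primitive case then applies. *)
Lemma nine_times_three_squares (a b c : Z) :
  0 < a * a + b * b + c * c ->
  exists x y z : Z, x * x + y * y + z * z = 9 * (a * a + b * b + c * c)
    /\ x mod 3 <> 0 /\ y mod 3 <> 0 /\ z mod 3 <> 0.
Proof.
  intros Hpos. remember (a * a + b * b + c * c) as n eqn:En.
  assert (Hn : 0 <= n) by lia. revert a b c En Hpos. pattern n.
  apply Zlt_0_ind; [|exact Hn]. clear n Hn.
  intros n IH _ a b c -> Hpos.
  assert (D : (a mod 3 <> 0 \/ b mod 3 <> 0 \/ c mod 3 <> 0)
    \/ (a = 3 * (a / 3) /\ b = 3 * (b / 3) /\ c = 3 * (c / 3))) by lia.
  destruct D as [D|[Ea [Eb Ec]]]; [now apply nine_times_three_squares_primitive|].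
  set (a' := a / 3) in *. set (b' := b / 3) in *. set (c' := c / 3) in *.
  clearbody a' b' c'. subst a b c.
  destruct (IH (a' * a' + b' * b' + c' * c')) with (a := a') (b := b') (c := c')
    as [x [y [z [E [Hx [Hy Hz]]]]]]; [lia|reflexivity|lia|].
  replace (3 * a' * (3 * a') + 3 * b' * (3 * b') + 3 * c' * (3 * c'))
    with (x * x + y * y + z * z) by lia.
  apply nine_times_three_squares_primitive. now left.
Qed.

Lemma three_squares_prime_to_3 (a b c : Z) :
  a mod 3 = 0 -> b mod 3 = 0 -> c mod 3 = 0 -> 0 < a * a + b * b + c * c ->
  exists x y z : Z, x * x + y * y + z * z = a * a + b * b + c * c
    /\ x mod 3 <> 0 /\ y mod 3 <> 0 /\ z mod 3 <> 0.
Proof.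
  intros Ha Hb Hc Hpos.
  assert (Ea : a = 3 * (a / 3)) by lia. assert (Eb : b = 3 * (b / 3)) by lia.
  assert (Ec : c = 3 * (c / 3)) by lia.
  destruct (nine_times_three_squares (a / 3) (b / 3) (c / 3)) as [x [y [z [E H]]]].
  { nia. }
  exists x, y, z. split; [|exact H]. rewrite E. nia.
Qed.

Lemma four_squares_prime_to_3 (n : Z) :
  1 < n -> n mod 3 = 1 ->
  exists a b c d : Z, a * a + b * b + c * c + d * d = n
    /\ a mod 3 <> 0 /\ b mod 3 <> 0 /\ c mod 3 <> 0 /\ d mod 3 <> 0.
Proof.
  intros Hn H3.
  destruct (four_squares_proper n Hn) as [a [b [c [d [E [Ha [Hb [Hc Hd]]]]]]]].
  assert (K : forall a b c d, a * a + b * b + c * c + d * d = n -> a * a < n ->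
    a mod 3 <> 0 -> b mod 3 = 0 -> c mod 3 = 0 -> d mod 3 = 0 ->
    exists a b c d : Z, a * a + b * b + c * c + d * d = n
    /\ a mod 3 <> 0 /\ b mod 3 <> 0 /\ c mod 3 <> 0 /\ d mod 3 <> 0).
  { clear. intros a b c d E Ha A B C D.
    destruct (three_squares_prime_to_3 b c d B C D) as [x [y [z [E' H]]]]; [lia|].
    exists a, x, y, z. split; [lia|tauto]. }
  assert (Hk : n = 3 * (n / 3) + 1) by lia. generalize dependent (n / 3). intros k Hk.
  destruct (square_by_residue_mod_3 a) as [[A [qa A']]|[A [qa A']]],
    (square_by_residue_mod_3 b) as [[B [qb B']]|[B [qb B']]],
    (square_by_residue_mod_3 c) as [[C [qc C']]|[C [qc C']]],
    (square_by_residue_mod_3 d) as [[D [qd D']]|[D [qd D']]];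
    try (exfalso; clear - E Hk A' B' C' D'; lia).
  - apply (K d a b c); trivial; clear - E; lia.
  - apply (K c a b d); trivial; clear - E; lia.
  - apply (K b a c d); trivial; clear - E; lia.
  - apply (K a b c d); trivial; clear - E; lia.
  - exists a, b, c, d. tauto.
Qed.

(** * Polygonal numbers as squares *)

Lemma polyg_3_eq (x : Z) : 8 * polyg 3 x + 1 = (2 * x + 1) * (2 * x + 1).
Proof.
  unfold polyg. pose proof (square_by_parity x).
  replace ((3 - 2) * x * x - (3 - 4) * x) with (x * x + x) by ring. lia.
Qed.

Lemma polyg_4_eq (x : Z) : polyg 4 x = x * x.
Proof.
  unfold polyg. replace ((4 - 2) * x * x - (4 - 4) * x) with ((x * x) * 2) by ring.
  now apply Z.div_mul.
Qed.

Lemma polyg_5_eq (x : Z) : 24 * polyg 5 x + 1 = (6 * x - 1) * (6 * x - 1).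
Proof.
  unfold polyg. pose proof (square_by_parity x).
  replace ((5 - 2) * x * x - (5 - 4) * x) with (3 * (x * x) - x) by ring. lia.
Qed.

Lemma polyg_8_eq (x : Z) : 3 * polyg 8 x + 1 = (3 * x - 1) * (3 * x - 1).
Proof.
  unfold polyg.
  replace ((8 - 2) * x * x - (8 - 4) * x) with ((x * (3 * x - 2)) * 2) by ring.
  rewrite Z.div_mul by lia. ring.
Qed.

Lemma polyg_nonneg (m x : Z) : In m [3; 4; 5; 8] -> 0 <= polyg m x.
Proof.
  pose proof (polyg_3_eq x). pose proof (polyg_4_eq x). pose proof (polyg_5_eq x).
  pose proof (polyg_8_eq x).
  pose proof (Z.square_nonneg (2 * x + 1)). pose proof (Z.square_nonneg x).
  pose proof (Z.square_nonneg (6 * x - 1)). pose proof (Z.square_nonneg (3 * x - 1)).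
  intros [<-|[<-|[<-|[<-|[]]]]]; lia.
Qed.

Lemma polyg_3_of_odd (y : Z) : y mod 2 = 1 -> exists x, 8 * polyg 3 x + 1 = y * y.
Proof.
  intros H. exists ((y - 1) / 2). rewrite polyg_3_eq.
  now replace (2 * ((y - 1) / 2) + 1) with y by lia.
Qed.

(** Numbers prime to 6 are 5 or 1 modulo 6; the first are [6 x - 1], the second their negatives. *)
Lemma polyg_5_of_prime_to_6 (y : Z) :
  y mod 2 = 1 -> y mod 3 <> 0 -> exists x, 24 * polyg 5 x + 1 = y * y.
Proof.
  intros H2 H3. assert (C : y mod 6 = 5 \/ y mod 6 = 1) by lia. destruct C.
  - exists ((y + 1) / 6). rewrite polyg_5_eq.
    now replace (6 * ((y + 1) / 6) - 1) with y by lia.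
  - exists ((1 - y) / 6). rewrite polyg_5_eq, <- Z.mul_opp_opp.
    now replace (- (6 * ((1 - y) / 6) - 1)) with y by lia.
Qed.

Lemma polyg_8_of_prime_to_3 (y : Z) :
  y mod 3 <> 0 -> exists x, 3 * polyg 8 x + 1 = y * y.
Proof.
  intros H3. assert (C : y mod 3 = 2 \/ y mod 3 = 1) by lia. destruct C.
  - exists ((y + 1) / 3). rewrite polyg_8_eq.
    now replace (3 * ((y + 1) / 3) - 1) with y by lia.
  - exists ((1 - y) / 3). rewrite polyg_8_eq, <- Z.mul_opp_opp.
    now replace (- (3 * ((1 - y) / 3) - 1)) with y by lia.
Qed.

Lemma universal_Z_intro (a r b s c t d u : Z) :
  0 <= a -> 0 <= b -> 0 <= c -> 0 <= d ->
  In r [3; 4; 5; 8] -> In s [3; 4; 5; 8] -> In t [3; 4; 5; 8] -> In u [3; 4; 5; 8] ->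
  (forall N, 0 <= N -> exists h l m n : Z,
    a * polyg r h + b * polyg s l + c * polyg t m + d * polyg u n = N) ->
  universal_Z a r b s c t d u.
Proof.
  intros Ha Hb Hc Hd Hr Hs Ht Hu H N. split; [exact (H N)|].
  intros [h [l [m [n <-]]]]. unfold quat_sum.
  pose proof (polyg_nonneg r h Hr). pose proof (polyg_nonneg s l Hs).
  pose proof (polyg_nonneg t m Ht). pose proof (polyg_nonneg u n Hu).
  repeat apply Z.add_nonneg_nonneg; now apply Z.mul_nonneg_nonneg.
Qed.

Ltac universal :=
  apply universal_Z_intro; [lia|lia|lia|lia|simpl; tauto|simpl; tauto|simpl; tauto|simpl; tauto|].

(** * Four squares with joint conditions modulo 2, 3 and 4 *)

(** Write [n] with four terms prime to 3. One or three are odd, so they split into a pair of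
    opposite parity and a pair of equal parity; replacing each pair by its sum and difference
    doubles [n] and gives two odd and two even terms. *)
Lemma twice_odd_four_squares_residues (n : Z) :
  1 < n -> n mod 2 = 1 -> n mod 3 = 1 ->
  exists a b c d : Z, a * a + b * b + c * c + d * d = 2 * n
    /\ a mod 2 = 1 /\ b mod 2 = 1 /\ c mod 2 = 0 /\ d mod 2 = 0
    /\ a mod 3 = 0 /\ b mod 3 <> 0 /\ c mod 3 = 0 /\ d mod 3 <> 0.
Proof.
  intros Hn H2 H3.
  (* When [a, b] are prime to 3, exactly one of [a + b, a - b] is divisible by 3. *)
  assert (P : forall a b, a mod 3 <> 0 -> b mod 3 <> 0 ->
    exists x y, x * x + y * y = 2 * (a * a + b * b) /\ x mod 2 = (a + b) mod 2
      /\ y mod 2 = (a + b) mod 2 /\ x mod 3 = 0 /\ y mod 3 <> 0).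
  { clear. intros a b A B.
    assert (S : (a + b) mod 3 = 0 \/ (a - b) mod 3 = 0) by lia. destruct S.
    - exists (a + b), (a - b). split; [ring|lia].
    - exists (a - b), (a + b). split; [ring|lia]. }
  assert (K : forall a b c d, a * a + b * b + c * c + d * d = n ->
    (a + b) mod 2 = 1 -> (c + d) mod 2 = 0 ->
    a mod 3 <> 0 -> b mod 3 <> 0 -> c mod 3 <> 0 -> d mod 3 <> 0 ->
    exists a b c d : Z, a * a + b * b + c * c + d * d = 2 * n
    /\ a mod 2 = 1 /\ b mod 2 = 1 /\ c mod 2 = 0 /\ d mod 2 = 0
    /\ a mod 3 = 0 /\ b mod 3 <> 0 /\ c mod 3 = 0 /\ d mod 3 <> 0).
  { clear - P. intros a b c d E Hab Hcd A B C D.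
    destruct (P a b A B) as [x [y [E1 [X [Y [X3 Y3]]]]]].
    destruct (P c d C D) as [z [w [E2 [Z [W [Z3 W3]]]]]].
    rewrite Hab in X, Y. rewrite Hcd in Z, W.
    exists x, y, z, w. repeat split; trivial; clear - E E1 E2; lia. }
  destruct (sort_by_parity _ _ (four_squares_prime_to_3 n Hn H3))
    as [a [b [c [d [E [[A [B [C D]]] [N1 [_ N3]]]]]]]].
  assert (Q : n mod 4 = 1 \/ n mod 4 = 3) by (clear - H2; lia).
  destruct Q as [Q|Q].
  - destruct (N1 Q) as [a2 [b2 [c2 d2]]]. clear - K E A B C D a2 b2 c2 d2.
    apply (K a b c d); trivial; clear - a2 b2 c2 d2; lia.
  - destruct (N3 Q) as [a2 [b2 [c2 d2]]]. clear - K E A B C D a2 b2 c2 d2.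
    apply (K d a b c); trivial; clear - E a2 b2 c2 d2; lia.
Qed.

(** The conditions on [b + c] and [d] make [(b + c) / 2] odd and, for a suitable sign,
    [(b + c) / 2 + d / 2] or [(b + c) / 2 - d / 2] prime to 3. *)
Lemma three_odd_squares_one_even_mod_3 (n : Z) :
  0 <= n -> n mod 4 = 3 ->
  exists a b c d : Z, a * a + b * b + c * c + d * d = n
    /\ a mod 2 = 1 /\ b mod 2 = 1 /\ c mod 2 = 1 /\ d mod 2 = 0
    /\ (b + c) mod 4 = 2 /\ a mod 3 <> 0 /\ ((b + c) mod 3 <> 0 \/ d mod 3 <> 0).
Proof.
  intros Hn H4.
  set (G := exists a b c d : Z, a * a + b * b + c * c + d * d = n
    /\ a mod 2 = 1 /\ b mod 2 = 1 /\ c mod 2 = 1 /\ d mod 2 = 0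
    /\ (b + c) mod 4 = 2 /\ a mod 3 <> 0 /\ ((b + c) mod 3 <> 0 \/ d mod 3 <> 0)).
  (* Signs make all odd terms congruent to 1 modulo 4; among three such terms prime to 3, two
     agree modulo 3, so their sum is prime to 3. *)
  assert (N : forall x, x mod 2 = 1 -> exists y, y * y = x * x /\ y mod 4 = 1
    /\ (y mod 3 = 0 <-> x mod 3 = 0)).
  { clear. intros x H. assert (C : x mod 4 = 1 \/ x mod 4 = 3) by lia. destruct C.
    - exists x. tauto.
    - exists (- x). split; [ring|lia]. }
  assert (K1 : forall a b c d, a * a + b * b + c * c + d * d = n ->
    a mod 2 = 1 -> b mod 2 = 1 -> c mod 2 = 1 -> d mod 2 = 0 ->
    a mod 3 <> 0 -> d mod 3 <> 0 -> G).
  { intros a b c d E A B C D A3 D3.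
    destruct (N b B) as [y [Ey [Y _]]]. destruct (N c C) as [z [Ez [Z _]]].
    exists a, y, z, d. rewrite Ey, Ez. repeat split; trivial; [| | |tauto];
      clear - Y Z; lia. }
  assert (K2 : forall a b c d, a * a + b * b + c * c + d * d = n ->
    a mod 2 = 1 -> b mod 2 = 1 -> c mod 2 = 1 -> d mod 2 = 0 ->
    a mod 3 <> 0 -> b mod 3 <> 0 -> c mod 3 = 0 -> G).
  { intros a b c d E A B C D A3 B3 C3.
    destruct (N b B) as [y [Ey [Y Y3]]]. destruct (N c C) as [z [Ez [Z Z3]]].
    exists a, y, z, d. rewrite Ey, Ez. repeat split; trivial;
      [clear - Y|clear - Z|clear - Y Z|left; clear - B3 C3 Y3 Z3]; lia. }
  assert (K3 : forall a b c d, a * a + b * b + c * c + d * d = n ->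
    a mod 2 = 1 -> b mod 2 = 1 -> c mod 2 = 1 -> d mod 2 = 0 ->
    a mod 3 <> 0 -> b mod 3 <> 0 -> c mod 3 <> 0 -> G).
  { intros a b c d E A B C D A3 B3 C3.
    assert (K : forall a b c, a * a + b * b + c * c + d * d = n ->
      a mod 4 = 1 -> b mod 4 = 1 -> c mod 4 = 1 -> a mod 3 <> 0 -> (b + c) mod 3 <> 0 -> G).
    { clear - D. intros a b c E A B C A3 S. exists a, b, c, d.
      repeat split; trivial; [clear - A|clear - B|clear - C|clear - B C|now left]; lia. }
    destruct (N a A) as [x [Ex [X X3]]].
    destruct (N b B) as [y [Ey [Y Y3]]]. destruct (N c C) as [z [Ez [Z Z3]]].
    rewrite <- X3 in A3. rewrite <- Y3 in B3. rewrite <- Z3 in C3.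
    assert (S : (y + z) mod 3 <> 0 \/ (x + z) mod 3 <> 0 \/ (x + y) mod 3 <> 0)
      by (clear - A3 B3 C3; lia).
    destruct S as [S|[S|S]]; [apply (K x y z)|apply (K y x z)|apply (K z x y)]; trivial;
      clear - E Ex Ey Ez; lia. }
  assert (L : forall Q : Z -> Prop,
    (exists a b c d : Z, a * a + b * b + c * c + d * d = n /\ Q a /\ Q b /\ Q c /\ Q d) ->
    exists a b c d : Z, a * a + b * b + c * c + d * d = n /\ (Q a /\ Q b /\ Q c /\ Q d)
    /\ a mod 2 = 1 /\ b mod 2 = 1 /\ c mod 2 = 1 /\ d mod 2 = 0).
  { intros Q H. apply sort_by_parity in H. destruct H as [a [b [c [d [E [H [_ [_ H3]]]]]]]].
    exists a, b, c, d. auto. }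
  destruct (Z.eq_dec (n mod 3) 1) as [N1|N1].
  { destruct (L _ (four_squares_prime_to_3 n ltac:(clear - Hn H4; lia) N1))
      as [x [y [z [w H]]]]. apply (K1 x y z w); tauto. }
  destruct (L (fun _ => True)) as [a [b [c [d [E [_ [A [B [C D]]]]]]]]].
  { destruct (lagrange_four_squares n Hn) as [a [b [c [d E]]]]. exists a, b, c, d. tauto. }
  clear L.
  assert (Hk : n = 3 * (n / 3) \/ n = 3 * (n / 3) + 2) by (clear - N1; lia).
  generalize dependent (n / 3). intros k Hk.
  destruct (square_by_residue_mod_3 a) as [[a3 [qa A3]]|[a3 [qa A3]]],
    (square_by_residue_mod_3 b) as [[b3 [qb B3]]|[b3 [qb B3]]],
    (square_by_residue_mod_3 c) as [[c3 [qc C3]]|[c3 [qc C3]]],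
    (square_by_residue_mod_3 d) as [[d3 [qd D3]]|[d3 [qd D3]]];
    try (exfalso; clear - E Hk A3 B3 C3 D3; lia); clear A3 B3 C3 D3 Hk N1.
  2-11: first
    [ apply (K1 a b c d); trivial; clear - E; lia
    | apply (K1 b a c d); trivial; clear - E; lia
    | apply (K1 c a b d); trivial; clear - E; lia
    | apply (K2 a b c d); trivial; clear - E; lia
    | apply (K2 a c b d); trivial; clear - E; lia
    | apply (K2 b c a d); trivial; clear - E; lia
    | apply (K3 a b c d); trivial; clear - E; lia ].
  (* All four terms are divisible by 3: the odd ones are reflected. They stay odd, since their
     squares add up to 3 modulo 4. *)
  destruct (three_squares_prime_to_3 a b c a3 b3 c3) as [x [y [z [E' [X [Y Z]]]]]].
  { clear - A. nia. }
  assert (E2 : x * x + y * y + z * z + d * d = n) by (clear - E E'; lia).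
  assert (H : x mod 2 = 1 /\ y mod 2 = 1 /\ z mod 2 = 1).
  { clear - E' A B C.
    destruct (square_by_parity a) as [[a2 [qa Ea]]|[a2 [qa Ea]]]; [congruence|].
    destruct (square_by_parity b) as [[b2 [qb Eb]]|[b2 [qb Eb]]]; [congruence|].
    destruct (square_by_parity c) as [[c2 [qc Ec]]|[c2 [qc Ec]]]; [congruence|].
    destruct (square_by_parity x) as [[x2 [qx Ex]]|[x2 [qx Ex]]],
      (square_by_parity y) as [[y2 [qy Ey]]|[y2 [qy Ey]]],
      (square_by_parity z) as [[z2 [qz Ez]]|[z2 [qz Ez]]];
      first [tauto | exfalso; clear - E' Ea Eb Ec Ex Ey Ez; lia]. }
  apply (K3 x y z d); tauto.
Qed.

(** * The sixteen sums *)

Ltac quotient H k := apply Z.mod_divide in H; [destruct H as [k ->]|lia].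

Ltac solve_sum h l m n :=
  exists h, l, m, n; rewrite ?polyg_4_eq; lia.

(** Times 12, [2 p_5] is [y^2 - 1] and [p_8] is [(2 z)^2 - 4], so the constants add up to 10. The
    constants in the other sums arise in the same way. *)
Lemma universal_2p5_2p5_p8_p8 : universal_Z 2 5 2 5 1 8 1 8.
Proof.
  universal. intros N HN.
  destruct (sort_by_parity _ _ (four_squares_prime_to_3 (12 * N + 10) ltac:(lia) ltac:(lia)))
    as [a [b [c [d [E [[A [B [C D]]] [_ [S _]]]]]]]].
  destruct S as [a2 [b2 [c2 d2]]]; [clear; lia|].
  quotient c2 c'. quotient d2 d'.
  destruct (polyg_5_of_prime_to_6 a a2 A) as [h Hh].
  destruct (polyg_5_of_prime_to_6 b b2 B) as [l Hl].
  destruct (polyg_8_of_prime_to_3 c') as [m Hm]; [clear - C; lia|].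
  destruct (polyg_8_of_prime_to_3 d') as [n Hn]; [clear - D; lia|].
  clear - E Hh Hl Hm Hn. solve_sum h l m n.
Qed.

Lemma universal_p8_p8_p8_p8 : universal_Z 1 8 1 8 1 8 1 8.
Proof.
  universal. intros N HN.
  destruct (four_squares_prime_to_3 (3 * N + 4)) as [a [b [c [d [E [A [B [C D]]]]]]]];
    [lia|lia|].
  destruct (polyg_8_of_prime_to_3 a A) as [h Hh].
  destruct (polyg_8_of_prime_to_3 b B) as [l Hl].
  destruct (polyg_8_of_prime_to_3 c C) as [m Hm].
  destruct (polyg_8_of_prime_to_3 d D) as [n Hn].
  clear - E Hh Hl Hm Hn. solve_sum h l m n.
Qed.

Lemma lagrange_sorted_mod_3 (n : Z) :
  0 <= n -> n mod 3 = 2 ->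
  exists a b c d : Z, a * a + b * b + c * c + d * d = n
    /\ a mod 3 <> 0 /\ b mod 3 <> 0 /\ c mod 3 = 0 /\ d mod 3 = 0.
Proof.
  intros Hn H3.
  destruct (sort_mod_3 (fun _ => True) n H3) as [a [b [c [d [E [_ H]]]]]].
  - destruct (lagrange_four_squares n Hn) as [a [b [c [d E]]]]. exists a, b, c, d. tauto.
  - exists a, b, c, d. tauto.
Qed.

Lemma universal_3p4_3p4_p8_p8 : universal_Z 3 4 3 4 1 8 1 8.
Proof.
  universal. intros N HN.
  destruct (lagrange_sorted_mod_3 (3 * N + 2)) as [a [b [c [d [E [A [B [C D]]]]]]]];
    [lia|lia|].
  quotient C c'. quotient D d'.
  destruct (polyg_8_of_prime_to_3 a A) as [m Hm].
  destruct (polyg_8_of_prime_to_3 b B) as [n Hn].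
  clear - E Hm Hn. solve_sum c' d' m n.
Qed.

Lemma universal_6p3_3p4_2p5_p8 : universal_Z 6 3 3 4 2 5 1 8.
Proof.
  universal. intros N HN.
  destruct (twice_odd_four_squares_residues (6 * N + 7))
    as [a [b [c [d [E [a2 [b2 [c2 [d2 [A [B [C D]]]]]]]]]]]]; [lia|lia|lia|].
  assert (C6 : c mod 6 = 0) by (clear - c2 C; lia). clear c2 C.
  quotient A a'. quotient C6 c'. quotient d2 d'.
  destruct (polyg_3_of_odd a') as [h Hh]; [clear - a2; lia|].
  destruct (polyg_5_of_prime_to_6 b b2 B) as [m Hm].
  destruct (polyg_8_of_prime_to_3 d') as [n Hn]; [clear - D; lia|].
  clear - E Hh Hm Hn. solve_sum h c' m n.
Qed.

(** The even terms recombine by [(2 c')^2 + (2 d')^2 = 2 (c' + d')^2 + 2 (c' - d')^2]. Modulo 8,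
    [c' + d'] is odd; as 3 divides only [c'], both new terms are prime to 3. *)
Lemma universal_3p3_p5_2p5_2p5 : universal_Z 3 3 1 5 2 5 2 5.
Proof.
  universal. intros N HN.
  destruct (twice_odd_four_squares_residues (12 * N + 7))
    as [a [b [c [d [E [a2 [b2 [c2 [d2 [A [B [C D]]]]]]]]]]]]; [lia|lia|lia|].
  quotient A a'. quotient c2 c'. quotient d2 d'.
  destruct (polyg_3_of_odd a') as [h Hh]; [clear - a2; lia|].
  destruct (polyg_5_of_prime_to_6 b b2 B) as [l Hl].
  assert (S : (c' + d') mod 2 = 1).
  { clear - E Hh Hl.
    destruct (square_by_parity c') as [[c2 [qc Ec]]|[c2 [qc Ec]]],
      (square_by_parity d') as [[d2 [qd Ed]]|[d2 [qd Ed]]];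
      first [exfalso; clear - E Hh Hl Ec Ed; lia | clear - c2 d2; lia]. }
  destruct (polyg_5_of_prime_to_6 (c' + d')) as [m Hm];
    [exact S|clear - C D; lia|].
  destruct (polyg_5_of_prime_to_6 (c' - d')) as [n Hn];
    [clear - S; lia|clear - C D; lia|].
  clear - E Hh Hl Hm Hn. solve_sum h l m n.
Qed.

(** Now [c'] and [d'] have equal parity modulo 8, and [(2 c')^2 + (2 d')^2] is 8 times the squares
    of their half sum [d' + v] and half difference [v]. *)
Lemma universal_3p3_p5_p8_p8 : universal_Z 3 3 1 5 1 8 1 8.
Proof.
  universal. intros N HN.
  destruct (twice_odd_four_squares_residues (12 * N + 13))
    as [a [b [c [d [E [a2 [b2 [c2 [d2 [A [B [C D]]]]]]]]]]]]; [lia|lia|lia|].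
  quotient A a'. quotient c2 c'. quotient d2 d'.
  destruct (polyg_3_of_odd a') as [h Hh]; [clear - a2; lia|].
  destruct (polyg_5_of_prime_to_6 b b2 B) as [l Hl].
  assert (S : (c' - d') mod 2 = 0).
  { clear - E Hh Hl.
    destruct (square_by_parity c') as [[c2 [qc Ec]]|[c2 [qc Ec]]],
      (square_by_parity d') as [[d2 [qd Ed]]|[d2 [qd Ed]]];
      first [exfalso; clear - E Hh Hl Ec Ed; lia | clear - c2 d2; lia]. }
  apply Z.mod_divide in S; [|lia]. destruct S as [v Hv].
  assert (Hc : c' = d' + v * 2) by (clear - Hv; lia). clear Hv. subst c'.
  destruct (polyg_8_of_prime_to_3 (d' + v)) as [m Hm]; [clear - C D; lia|].
  destruct (polyg_8_of_prime_to_3 v) as [n Hn]; [clear - C D; lia|].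
  clear - E Hh Hl Hm Hn. solve_sum h l m n.
Qed.

Lemma universal_3p4_p5_p5_p8 : universal_Z 3 4 1 5 1 5 1 8.
Proof.
  universal. intros N HN.
  (* Doubling turns [u^2 + v^2] into the squares of [u + v] and [u - v], which are prime to 6 when
     exactly one of [u], [v] is odd and exactly one is divisible by 3. *)
  assert (K : forall u v w x, u * u + v * v + w * w + x * x = 12 * N + 5 ->
    u mod 2 = 1 -> v mod 2 = 0 -> w mod 2 = 0 -> x mod 2 = 0 ->
    (u + v) mod 3 <> 0 -> (u - v) mod 3 <> 0 -> w mod 3 <> 0 -> x mod 3 = 0 ->
    exists h l m n : Z, 3 * polyg 4 h + 1 * polyg 5 l + 1 * polyg 5 m + 1 * polyg 8 n = N).
  { clear. intros u v w x E U V W X P M W3 X3.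
    assert (X6 : x mod 6 = 0) by (clear - X X3; lia). clear X X3.
    quotient X6 x'. quotient W w'.
    destruct (polyg_5_of_prime_to_6 (u + v)) as [l Hl]; [clear - U V; lia|exact P|].
    destruct (polyg_5_of_prime_to_6 (u - v)) as [m Hm]; [clear - U V; lia|exact M|].
    destruct (polyg_8_of_prime_to_3 w') as [n Hn]; [clear - W3; lia|].
    clear - E Hl Hm Hn. solve_sum x' l m n. }
  destruct (lagrange_sorted_mod_3 (12 * N + 5)) as [a [b [c [d [E [A [B [C D]]]]]]]];
    [lia|lia|].
  destruct (square_by_parity a) as [[a2 [qa Ea]]|[a2 [qa Ea]]],
    (square_by_parity b) as [[b2 [qb Eb]]|[b2 [qb Eb]]],
    (square_by_parity c) as [[c2 [qc Ec]]|[c2 [qc Ec]]],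
    (square_by_parity d) as [[d2 [qd Ed]]|[d2 [qd Ed]]];
    try (exfalso; clear - E Ea Eb Ec Ed; lia); clear Ea Eb Ec Ed.
  - apply (K d a b c); trivial; [clear - E|clear - A D|clear - A D]; lia.
  - apply (K c a b d); trivial; [clear - E|clear - A C|clear - A C]; lia.
  - apply (K b c a d); trivial; [clear - E|clear - B C|clear - B C]; lia.
  - apply (K a c b d); trivial; [clear - E|clear - A C|clear - A C]; lia.
Qed.

Lemma universal_6p3_p5_p5_2p5 : universal_Z 6 3 1 5 1 5 2 5.
Proof.
  universal. intros N HN.
  assert (K : forall u v w x, u * u + v * v + w * w + x * x = 12 * N + 11 ->
    u mod 2 = 0 -> v mod 2 = 1 -> w mod 2 = 1 -> x mod 2 = 1 ->
    (u + v) mod 3 <> 0 -> (u - v) mod 3 <> 0 -> w mod 3 <> 0 -> x mod 3 = 0 ->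
    exists h l m n : Z, 6 * polyg 3 h + 1 * polyg 5 l + 1 * polyg 5 m + 2 * polyg 5 n = N).
  { clear. intros u v w x E U V W X P M W3 X3.
    quotient X3 x'.
    destruct (polyg_3_of_odd x') as [h Hh]; [clear - X; lia|].
    destruct (polyg_5_of_prime_to_6 (u + v)) as [l Hl]; [clear - U V; lia|exact P|].
    destruct (polyg_5_of_prime_to_6 (u - v)) as [m Hm]; [clear - U V; lia|exact M|].
    destruct (polyg_5_of_prime_to_6 w W W3) as [n Hn].
    clear - E Hh Hl Hm Hn. solve_sum h l m n. }
  destruct (lagrange_sorted_mod_3 (12 * N + 11)) as [a [b [c [d [E [A [B [C D]]]]]]]];
    [lia|lia|].
  destruct (square_by_parity a) as [[a2 [qa Ea]]|[a2 [qa Ea]]],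
    (square_by_parity b) as [[b2 [qb Eb]]|[b2 [qb Eb]]],
    (square_by_parity c) as [[c2 [qc Ec]]|[c2 [qc Ec]]],
    (square_by_parity d) as [[d2 [qd Ed]]|[d2 [qd Ed]]];
    try (exfalso; clear - E Ea Eb Ec Ed; lia); clear Ea Eb Ec Ed.
  - apply (K a c b d); trivial; [clear - E|clear - A C|clear - A C]; lia.
  - apply (K b c a d); trivial; [clear - E|clear - B C|clear - B C]; lia.
  - apply (K c a b d); trivial; [clear - E|clear - A C|clear - A C]; lia.
  - apply (K d a b c); trivial; [clear - E|clear - A D|clear - A D]; lia.
Qed.

Lemma universal_p5_p5_p5_4p5 : universal_Z 1 5 1 5 1 5 4 5.
Proof.
  universal. intros N HN.
  destruct (sort_by_parity _ _ (four_squares_prime_to_3 (24 * N + 7) ltac:(lia) ltac:(lia)))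
    as [a [b [c [d [E [[A [B [C D]]] [_ [_ S]]]]]]]].
  destruct S as [a2 [b2 [c2 d2]]]; [clear; lia|].
  quotient d2 d'.
  destruct (polyg_5_of_prime_to_6 a a2 A) as [h Hh].
  destruct (polyg_5_of_prime_to_6 b b2 B) as [l Hl].
  destruct (polyg_5_of_prime_to_6 c c2 C) as [m Hm].
  (* Three odd squares leave [4 d'^2] equal to 4 modulo 8. *)
  destruct (square_by_parity d') as [[d2 [qd Ed]]|[d2 _]].
  { exfalso. clear - E Hh Hl Hm Ed. lia. }
  destruct (polyg_5_of_prime_to_6 d' d2) as [n Hn]; [clear - D; lia|].
  clear - E Hh Hl Hm Hn. solve_sum h l m n.
Qed.

Lemma universal_p5_p5_p5_2p8 : universal_Z 1 5 1 5 1 5 2 8.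
Proof.
  universal. intros N HN.
  destruct (sort_by_parity _ _ (four_squares_prime_to_3 (24 * N + 19) ltac:(lia) ltac:(lia)))
    as [a [b [c [d [E [[A [B [C D]]] [_ [_ S]]]]]]]].
  destruct S as [a2 [b2 [c2 d2]]]; [clear; lia|].
  quotient d2 d'.
  destruct (polyg_5_of_prime_to_6 a a2 A) as [h Hh].
  destruct (polyg_5_of_prime_to_6 b b2 B) as [l Hl].
  destruct (polyg_5_of_prime_to_6 c c2 C) as [m Hm].
  destruct (square_by_parity d') as [[d2 _]|[d2 [qd Ed]]].
  2: { exfalso. clear - E Hh Hl Hm Ed. lia. }
  quotient d2 w.
  destruct (polyg_8_of_prime_to_3 w) as [n Hn]; [clear - D; lia|].
  clear - E Hh Hl Hm Hn. solve_sum h l m n.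
Qed.

Lemma universal_p3_p3_2p4_3p5 : universal_Z 1 3 1 3 2 4 3 5.
Proof.
  universal. intros N HN.
  destruct (three_odd_squares_one_even_mod_3 (8 * N + 3))
    as [a [b [c [d [E [a2 [b2 [c2 [d2 [_ [A _]]]]]]]]]]]; [lia|lia|].
  quotient d2 d'.
  destruct (polyg_3_of_odd b b2) as [h Hh].
  destruct (polyg_3_of_odd c c2) as [l Hl].
  destruct (polyg_5_of_prime_to_6 a a2 A) as [n Hn].
  destruct (square_by_parity d') as [[d2 _]|[d2 [qd Ed]]].
  2: { exfalso. clear - E Hh Hl Hn Ed. lia. }
  quotient d2 w.
  clear - E Hh Hl Hn. solve_sum h l w n.
Qed.

Lemma universal_p3_p3_4p3_3p5 : universal_Z 1 3 1 3 4 3 3 5.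
Proof.
  universal. intros N HN.
  destruct (three_odd_squares_one_even_mod_3 (8 * N + 7))
    as [a [b [c [d [E [a2 [b2 [c2 [d2 [_ [A _]]]]]]]]]]]; [lia|lia|].
  quotient d2 d'.
  destruct (polyg_3_of_odd b b2) as [h Hh].
  destruct (polyg_3_of_odd c c2) as [l Hl].
  destruct (polyg_5_of_prime_to_6 a a2 A) as [n Hn].
  destruct (square_by_parity d') as [[d2 [qd Ed]]|[d2 _]].
  { exfalso. clear - E Hh Hl Hn Ed. lia. }
  destruct (polyg_3_of_odd d' d2) as [m Hm].
  clear - E Hh Hl Hm Hn. solve_sum h l m n.
Qed.

(* Write [p = (b + c) / 2], [x = (b - c) / 4], [q = +-d / 2] and use
   [(p - 2q)^2 + 2(p + q)^2 = 3(p^2 + 2q^2)]; the sign of [q] makes [p + q] prime to 3. *)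
Lemma three_times_square_eight_squares (n : Z) :
  0 <= n -> n mod 4 = 3 ->
  exists x p q z : Z,
    24 * (x * x) + 2 * ((p - 2 * q) * (p - 2 * q)) + 3 * (z * z) + 4 * ((p + q) * (p + q))
      = 3 * n
    /\ p mod 2 = 1 /\ z mod 2 = 1 /\ z mod 3 <> 0 /\ (p + q) mod 3 <> 0.
Proof.
  intros Hn H4.
  destruct (three_odd_squares_one_even_mod_3 n Hn H4)
    as [a [b [c [d [E [a2 [b2 [c2 [d2 [S [A T]]]]]]]]]]].
  quotient d2 q.
  assert (V : (b - c) mod 4 = 0) by (clear - b2 c2 S; lia).
  apply Z.mod_divide in V; [|lia]. destruct V as [x Hx].
  assert (Hb : b = c + x * 4) by (clear - Hx; lia). clear Hx. subst b.
  assert (K : forall r, r * r = q * q -> (c + 2 * x + r) mod 3 <> 0 ->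
    exists x p q z : Z,
    24 * (x * x) + 2 * ((p - 2 * q) * (p - 2 * q)) + 3 * (z * z) + 4 * ((p + q) * (p + q))
      = 3 * n
    /\ p mod 2 = 1 /\ z mod 2 = 1 /\ z mod 3 <> 0 /\ (p + q) mod 3 <> 0).
  { intros r Hr H. exists x, (c + 2 * x), r, a. repeat split; trivial.
    - clear - E Hr. lia.
    - clear - c2. lia. }
  assert (C : (c + 2 * x + q) mod 3 <> 0 \/ (c + 2 * x + - q) mod 3 <> 0)
    by (clear - T; lia).
  destruct C as [C|C].
  - apply (K q); trivial.
  - apply (K (- q)); [ring|exact C].
Qed.

Lemma universal_p4_2p5_3p5_4p5 : universal_Z 1 4 2 5 3 5 4 5.
Proof.
  universal. intros N HN.
  destruct (three_times_square_eight_squares (8 * N + 3))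
    as [x [p [q [z [E [p2 [z2 [Z3 S]]]]]]]]; [lia|lia|].
  (* [p - 2 q] is congruent to [p + q] modulo 3 and to [p] modulo 2; the parity of [p + q] follows
     from [E] modulo 8. *)
  destruct (polyg_5_of_prime_to_6 (p - 2 * q)) as [l Hl]; [clear - p2; lia|clear - S; lia|].
  destruct (polyg_5_of_prime_to_6 z z2 Z3) as [m Hm].
  destruct (polyg_5_of_prime_to_6 (p + q)) as [n Hn]; [|exact S|].
  { destruct (square_by_parity (p + q)) as [[_ [k Ek]]|[H _]]; [exfalso|exact H].
    clear - E Hl Hm Ek. lia. }
  exists x, l, m, n. rewrite polyg_4_eq. clear - E Hl Hm Hn. lia.
Qed.

Lemma universal_p4_2p5_3p5_2p8 : universal_Z 1 4 2 5 3 5 2 8.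
Proof.
  universal. intros N HN.
  destruct (three_times_square_eight_squares (8 * N + 7))
    as [x [p [q [z [E [p2 [z2 [Z3 S]]]]]]]]; [lia|lia|].
  destruct (polyg_5_of_prime_to_6 (p - 2 * q)) as [l Hl]; [clear - p2; lia|clear - S; lia|].
  destruct (polyg_5_of_prime_to_6 z z2 Z3) as [m Hm].
  destruct (square_by_parity (p + q)) as [[H _]|[_ [k Ek]]].
  2: { exfalso. clear - E Hl Hm Ek. lia. }
  apply Z.mod_divide in H; [|lia]. destruct H as [w Hw]. rewrite Hw in S, E.
  destruct (polyg_8_of_prime_to_3 w) as [n Hn]; [clear - S; lia|].
  exists x, l, m, n. rewrite polyg_4_eq. clear - E Hl Hm Hn. lia.
Qed.

Lemma universal_2p5_2p5_2p5_p8 : universal_Z 2 5 2 5 2 5 1 8.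
Proof.
  universal. intros N HN.
  destruct (sort_by_parity _ _ (four_squares_prime_to_3 (12 * N + 7) ltac:(lia) ltac:(lia)))
    as [a [b [c [d [E [[A [B [C D]]] [_ [_ S]]]]]]]].
  destruct S as [a2 [b2 [c2 d2]]]; [clear; lia|].
  quotient d2 d'.
  destruct (polyg_5_of_prime_to_6 a a2 A) as [h Hh].
  destruct (polyg_5_of_prime_to_6 b b2 B) as [l Hl].
  destruct (polyg_5_of_prime_to_6 c c2 C) as [m Hm].
  destruct (polyg_8_of_prime_to_3 d') as [n Hn]; [clear - D; lia|].
  clear - E Hh Hl Hm Hn. solve_sum h l m n.
Qed.

Lemma universal_2p5_p8_p8_p8 : universal_Z 2 5 1 8 1 8 1 8.
Proof.
  universal. intros N HN.
  destruct (sort_by_parity _ _ (four_squares_prime_to_3 (12 * N + 13) ltac:(lia) ltac:(lia)))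
    as [a [b [c [d [E [[A [B [C D]]] [S _]]]]]]].
  destruct S as [a2 [b2 [c2 d2]]]; [clear; lia|].
  quotient b2 b'. quotient c2 c'. quotient d2 d'.
  destruct (polyg_5_of_prime_to_6 a a2 A) as [h Hh].
  destruct (polyg_8_of_prime_to_3 b') as [l Hl]; [clear - B; lia|].
  destruct (polyg_8_of_prime_to_3 c') as [m Hm]; [clear - C; lia|].
  destruct (polyg_8_of_prime_to_3 d') as [n Hn]; [clear - D; lia|].
  clear - E Hh Hl Hm Hn. solve_sum h l m n.
Qed.

Theorem theorem3p3 :
  forall a r b s c t d u : Z,
    In (a, r, b, s, c, t, d, u) sums_3p3 -> universal_Z a r b s c t d u.
Proof.
  intros a r b s c t d u H. unfold sums_3p3 in H. simpl In in H.
  repeat (destruct H as [H|H]; [injection H as <- <- <- <- <- <- <- <-|]).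
  - exact universal_2p5_2p5_p8_p8.
  - exact universal_p8_p8_p8_p8.
  - exact universal_3p4_3p4_p8_p8.
  - exact universal_6p3_3p4_2p5_p8.
  - exact universal_3p3_p5_2p5_2p5.
  - exact universal_3p3_p5_p8_p8.
  - exact universal_3p4_p5_p5_p8.
  - exact universal_6p3_p5_p5_2p5.
  - exact universal_p5_p5_p5_4p5.
  - exact universal_p5_p5_p5_2p8.
  - exact universal_p3_p3_2p4_3p5.
  - exact universal_p3_p3_4p3_3p5.
  - exact universal_p4_2p5_3p5_4p5.
  - exact universal_p4_2p5_3p5_2p8.
  - exact universal_2p5_2p5_2p5_p8.
  - exact universal_2p5_p8_p8_p8.
  - destruct H.
Qed.
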